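(* Let $\mathsf a=(\mathsf a_{\ell,\ell'})_{\ell,\ell'\ge0}$, $\mathsf b=(\mathsf b_{\ell,\ell'})$, $\mathsf c=(\mathsf c_{\ell,\ell'})$, $\mathsf d=(\mathsf d_{\ell,\ell'})$, $\mathsf e=(\mathsf e_\ell)_{\ell\ge0}$, $\mathsf f=(\mathsf f_\ell)_{\ell\ge0}$ be indeterminates, and for $n\ge0$ define $$Q_n=\sum_{\sigma\in\mathfrak D_{2n}}\prod_{i\in\mathrm{Cval}(\sigma)}\mathsf a_{\mathrm{ucross}(i,\sigma),\mathrm{unest}(i,\sigma)}\prod_{i\in\mathrm{Cpeak}(\sigma)}\mathsf b_{\mathrm{lcross}(i,\sigma),\mathrm{lnest}(i,\sigma)}\prod_{i\in\mathrm{Cdfall}(\sigma)}\mathsf c_{\mathrm{lcross}(i,\sigma),\mathrm{lnest}(i,\sigma)}\prod_{i\in\mathrm{Cdrise}(\sigma)}\mathsf d_{\mathrm{ucross}(i,\sigma),\mathrm{unest}(i,\sigma)}\prod_{i\in\mathrm{Evenfix}(\sigma)}\mathsf e_{\mathrm{psnest}(i,\sigma)}\prod_{i\in\mathrm{Oddfix}(\sigma)}\mathsf f_{\mathrm{psnest}(i,\sigma)}.$$ Then $\sum_{n\ge0}Q_nt^n$ equals the T-type continued fraction with coefficients $\alpha_{2k-1}=\Bigl(\sum_{\xi=0}^{k-1}\mathsf a_{k-1-\xi,\xi}\Bigr)\Bigl(\sum_{\xi=0}^{k-1}\mathsf b_{k-1-\xi,\xi}\Bigr)$, $\alpha_{2k}=\Bigl(\mathsf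 e_k+\sum_{\xi=0}^{k-1}\mathsf c_{k-1-\xi,\xi}\Bigr)\Bigl(\mathsf f_k+\sum_{\xi=0}^{k-1}\mathsf d_{k-1-\xi,\xi}\Bigr)$ for $k\ge1$, $\delta_1=\mathsf e_0\mathsf f_0$, $\delta_n=0$ for $n\ge2$.
   Context: $\mathfrak D_{2n}$ is the set of permutations $\sigma$ of $[2n]$ with $\sigma(2k-1)\ge2k-1$ and $\sigma(2k)\le2k$ for all $k\in[n]$. $\mathrm{Cval}(\sigma)=\{i:\sigma^{-1}(i)>i<\sigma(i)\}$, $\mathrm{Cpeak}(\sigma)=\{i:\sigma^{-1}(i)<i>\sigma(i)\}$, $\mathrm{Cdrise}(\sigma)=\{i:\sigma^{-1}(i)<i<\sigma(i)\}$, $\mathrm{Cdfall}(\sigma)=\{i:\sigma^{-1}(i)>i>\sigma(i)\}$, $\mathrm{Evenfix}(\sigma)$ and $\mathrm{Oddfix}(\sigma)$ are the sets of even, resp. odd, fixed points. $\mathrm{ucross}(j,\sigma)=\#\{(i,k,l):i<j<k<l,\ k=\sigma(i),\ l=\sigma(j)\}$, $\mathrm{unest}(j,\sigma)=\#\{(i,k,l):i<j<k<l,\ k=\sigma(j),\ l=\sigma(i)\}$, $\mathrm{lcross}(k,\sigma)=\#\{(i,j,l):i<j<k<l,\ i=\sigma(k),\ j=\sigma(l)\}$, $\mathrm{lnest}(k,\sigma)=\#\{(i,j,l):i<j<k<l,\ i=\sigma(l),\ j=\sigma(k)\}$; for a fixed point $j$, $\mathrm{psnest}(j,\sigma)=\#\{i<j:\sigma(i)>j\}$.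 The T-type continued fraction with coefficients $(\alpha_n)_{n\ge1},(\delta_n)_{n\ge1}$ is the formal power series $1/(1-\delta_1t-\alpha_1t/(1-\delta_2t-\alpha_2t/(1-\delta_3t-\cdots)))$. *)

(* Defs.v *)
From HB Require Import structures.
From mathcomp Require Import all_boot all_order all_algebra all_fingroup.

Set Implicit Arguments.
Unset Strict Implicit.
Unset Printing Implicit Defensive.

Import GRing.Theory.
Local Open Scope ring_scope.

(* A permutation of [m] = {1, .., m} is a permutation of 'I_m = {0, .., m-1},
   with i : 'I_m standing for the label i.+1.  Order comparisons do not see
   the shift; parities do, hence the "odd i.+1" below. *)

Section PermutationStatistics.
Variable m : nat.
Implicit Types (s : 'S_m) (i j k l : 'I_m).

Definition Cval s : {set 'I_m} :=
  [set i : 'I_m | (i < (s^-1)%g i) && (i < s i)]%N.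
Definition Cpeak s : {set 'I_m} :=
  [set i : 'I_m | ((s^-1)%g i < i) && (s i < i)]%N.
Definition Cdrise s : {set 'I_m} :=
  [set i : 'I_m | ((s^-1)%g i < i) && (i < s i)]%N.
Definition Cdfall s : {set 'I_m} :=
  [set i : 'I_m | (i < (s^-1)%g i) && (s i < i)]%N.
Definition Evenfix s : {set 'I_m} :=
  [set i : 'I_m | (s i == i) && ~~ odd i.+1].
Definition Oddfix s : {set 'I_m} :=
  [set i : 'I_m | (s i == i) && odd i.+1].

Definition ucross j s : nat :=
  #|[set t : 'I_m * 'I_m * 'I_m | let: (i, k, l) := t in
      [&& (i < j)%N, (j < k)%N, (k < l)%N, k == s i & l == s j]]|.
Definition unest j s : nat :=
  #|[set t : 'I_m * 'I_m * 'I_m | let: (i, k, l) := t in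
      [&& (i < j)%N, (j < k)%N, (k < l)%N, k == s j & l == s i]]|.
Definition lcross k s : nat :=
  #|[set t : 'I_m * 'I_m * 'I_m | let: (i, j, l) := t in
      [&& (i < j)%N, (j < k)%N, (k < l)%N, i == s k & j == s l]]|.
Definition lnest k s : nat :=
  #|[set t : 'I_m * 'I_m * 'I_m | let: (i, j, l) := t in
      [&& (i < j)%N, (j < k)%N, (k < l)%N, i == s l & j == s k]]|.
Definition psnest j s : nat :=
  #|[set i : 'I_m | (i < j)%N && (j < s i)%N]|.

End PermutationStatistics.

Definition Dperm (n : nat) : {set 'S_(2 * n)} :=
  [set s : 'S_(2 * n) | [forall i : 'I_(2 * n),
     if odd i.+1 then (i <= s i)%N else (s i <= i)%N]].

Definition Qpoly (R : comNzRingType) (a b c d : nat -> nat -> R)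
    (e f : nat -> R) (n : nat) : R :=
  \sum_(s in Dperm n)
    (\prod_(i in Cval s) a (ucross i s) (unest i s)) *
    (\prod_(i in Cpeak s) b (lcross i s) (lnest i s)) *
    (\prod_(i in Cdfall s) c (lcross i s) (lnest i s)) *
    (\prod_(i in Cdrise s) d (ucross i s) (unest i s)) *
    (\prod_(i in Evenfix s) e (psnest i s)) *
    (\prod_(i in Oddfix s) f (psnest i s)).

(* Formal power series in t, as coefficient sequences. *)
Definition fps (R : Type) := nat -> R.

Section FormalPowerSeries.
Variable R : comNzRingType.
Implicit Types (u v : fps R).

Definition fps0 : fps R := fun=> 0.
Definition fps1 : fps R := fun n => (n == 0%N)%:R.
Definition fps_sub u v : fps R := fun n => u n - v n.
Definition fps_scale (x : R) u : fps R := fun n => x * u n.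
Definition fps_mul u v : fps R := fun n => \sum_(i < n.+1) u i * v (n - i)%N.
Definition fpsX : fps R := fun n => (n == 1%N)%:R.
Definition fps_exp u (k : nat) : fps R := iter k (fps_mul u) fps1.

(* 1 / u = \sum_k (1 - u)^k when u has constant term 1: only the terms
   k <= n then contribute to the coefficient of t^n (fps_exp_small). *)
Definition fps_inv u : fps R :=
  fun n => \sum_(k < n.+1) fps_exp (fps_sub fps1 u) k n.

Lemma fps_exp_small u k n : u 0%N = 0 -> (n < k)%N -> fps_exp u k n = 0.
Proof.
move=> u0; elim: k n => // k IHk n ltnk.
rewrite /fps_exp iterS -/(fps_exp u k) /fps_mul big1 // => -[[|i] lti] _ /=.
  by rewrite u0 mul0r.
rewrite IHk ?mulr0 //; case: n lti ltnk => [|n] // _ ltnk.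
exact: leq_ltn_trans (leq_subr i n) ltnk.
Qed.

Lemma fps_mulfV u : u 0%N = 1 -> fps_mul u (fps_inv u) =1 fps1.
Proof.
move=> u0 n; pose w := fps_sub fps1 u.
have w0 : w 0%N = 0 by rewrite /w /fps_sub u0 subrr.
have uE i : u i = fps1 i - w i by rewrite /w /fps_sub subKr.
rewrite /fps_mul; under eq_bigr => i _ do rewrite uE mulrBl.
rewrite sumrB big_ord_recl /= mul1r subn0 big1 ?addr0; last first.
  by move=> i _; rewrite mul0r.
suff -> : \sum_(i < n.+1) w i * fps_inv u (n - i)%N =
          \sum_(k < n.+1) fps_exp w k.+1 n.
  rewrite [fps_inv u n]/fps_inv -/w big_ord_recl.
  rewrite [X in _ - X]big_ord_recr [X in _ + X - _](_ : _ = \sum_(k < n) fps_exp w k.+1 n) //.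
  rewrite [X in _ - X](_ : _ = \sum_(k < n) fps_exp w k.+1 n + fps_exp w n.+1 n) //.
  rewrite (@fps_exp_small w n.+1) // addr0.
  by rewrite addrK.
have invE (i : 'I_n.+1) :
    fps_inv u (n - i)%N = \sum_(k < n.+1) fps_exp w k (n - i)%N.
  rewrite /fps_inv -/w.
  rewrite (big_ord_widen n.+1 (fun k => fps_exp w k (n - i)%N)) ?ltnS ?leq_subr //.
  rewrite [RHS](bigID (fun k : 'I__ => (k < (n - i).+1)%N)) /=.
  rewrite [X in _ = _ + X]big1 ?addr0 // => k; rewrite -leqNgt => ltk.
  exact: fps_exp_small.
under eq_bigr => i _ do rewrite invE mulr_sumr.
by rewrite exchange_big.
Qed.

Section TFraction.
(* Only the values at indices >= 1 are used. *)
Variables alpha delta : nat -> R.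

(* 1/(1 - delta_k t - alpha_k t/(1 - delta_(k+1) t - ...)), with N levels, the
   last denominator being 1 - delta_(k+N-1) t. *)
Fixpoint tfrac_trunc (N k : nat) : fps R :=
  if N is N'.+1 then
    fps_inv (fps_sub (fps_sub fps1 (fps_scale (delta k) fpsX))
      (fps_mul (fps_scale (alpha k) fpsX) (tfrac_trunc N' k.+1)))
  else fps0.

(* The infinite continued fraction is the limit of its truncations in the
   t-adic topology. *)
Definition is_tfraction u : Prop :=
  forall n, exists N0, forall N, (N0 <= N)%N -> tfrac_trunc N 1 n = u n.

End TFraction.
End FormalPowerSeries.

(* Main.v *)
Require Import Defs.
From Stdlib Require Import FunctionalExtensionality.
From HB Require Import structures.
From mathcomp Require Import all_boot all_order all_algebra all_fingroup.
From mathcomp Require Import zify ring.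

Set Implicit Arguments.
Unset Strict Implicit.
Unset Printing Implicit Defensive.

Import GRing.Theory.
Local Open Scope ring_scope.

(* Call type of a permutation the function that tells, for each x, whether x is
   fixed or on which side of x lies its preimage.  A permutation in D_2n of a
   given type is built by choosing the images of the odd labels from right to
   left, then those of the even labels from left to right.  At each step the
   images still available on the right side of x form a set whose cardinal h
   depends on the type only, and the crossings and nestings counted at x are the
   numbers of available images before and after the chosen one: the step
   contributes the sum of the weights w (h - 1 - xi) xi over xi < h.  The sum over
   the types is then a sum over paths in which h is the height; taking heights at
   odd and even positions as the even and odd levels of a Dyck path turns it into
   the continued fraction. *)

Definition total_weight (R : nmodType) (w : nat -> nat -> R) (h : nat) : R :=
  \sum_(0 <= xi < h) w (h - 1 - xi)%N xi.

Lemma total_weight0 (R : nmodType) (w : nat -> nat -> R) : total_weight w 0 = 0.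
Proof. by rewrite /total_weight big_geq. Qed.

(** * Permutations built by successive choices of images *)

Section SequentialChoice.
Variables (R : comNzRingType) (I : finType) (w : I -> I -> {set I} -> R).
Implicit Types (s : {perm I}) (L P : seq I) (M : {set I}).

(** [M] is the set of images still available when the head of [L] is treated. *)
Fixpoint choice_weight s L M : R :=
  if L is x :: L' then w x (s x) M * choice_weight s L' (M :\ s x) else 1.

Fixpoint choice_sum L M : R :=
  if L is x :: L' then \sum_(y in M) w x y M * choice_sum L' (M :\ y) else 1.

(** The induction on [L] needs a prefix [P] of positions already treated, whose images are frozen to
    those of a reference [s0]. *)
Lemma sum_choice_weight_prefix s0 P L :
  uniq (P ++ L) -> (forall x, x \in P ++ L) ->
  \sum_(s : {perm I} | all (fun x => s x == s0 x) P)
     choice_weight s L (~: s0 @: [set x in P])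
  = choice_sum L (~: s0 @: [set x in P]).
Proof.
elim: L P s0 => [|x L IHL] P s0 uPL PLT /=.
  rewrite (big_pred1 s0) // => s /=; apply/allP/eqP => [eqs|-> //].
  by apply/permP => x; apply/eqP/eqs; rewrite -[P]cats0.
set M := ~: _.
rewrite (partition_big (fun s : {perm I} => s x) (mem M)) /=; last first.
  move=> s /allP eqs; rewrite !inE; apply/imsetP=> -[y]; rewrite inE => Py.
  rewrite -(eqP (eqs y Py)) => /perm_inj xy; move: uPL.
  by rewrite cat_uniq /= xy Py andbF.
(* [s1] agrees with [s0] on [P] and sends [x] to [y]: it is the reference for the prefix extended by
   [x]. *)
apply: eq_bigr => y My; pose s1 := (s0 * tperm (s0 x) y)%g.
have s1x : s1 x = y by rewrite permM tpermL.
have s1P z : z \in P -> s1 z = s0 z.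
  move=> Pz; rewrite permM tpermD //.
    apply/eqP=> /perm_inj xz; move: uPL.
    by rewrite cat_uniq /= xz Pz andbF.
  by apply: contraTneq My => ->; rewrite inE negbK imset_f // inE.
have := IHL (rcons P x) s1; rewrite cat_rcons => /(_ uPL PLT).
have -> : ~: s1 @: [set z in rcons P x] = M :\ y.
  have -> : [set z in rcons P x] = x |: [set z in P].
    by apply/setP=> z; rewrite !inE mem_rcons inE.
  rewrite imsetU1 s1x (@eq_in_imset _ _ s1 s0) => [|z]; last by rewrite inE => /s1P.
  by rewrite setCU setIC setDE.
move=> <-; rewrite mulr_sumr; apply: eq_big => [s | s /andP[_ /eqP->//]].
rewrite all_rcons s1x andbC; congr (_ && _).
by apply: eq_in_all => z Pz; rewrite s1P.
Qed.

Lemma sum_choice_weight L :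
  uniq L -> (forall x, x \in L) ->
  \sum_(s : {perm I}) choice_weight s L setT = choice_sum L setT.
Proof.
move=> uL LT; have := @sum_choice_weight_prefix 1%g [::] L uL LT.
rewrite [[set _ in _]](_ : _ = set0); last by apply/setP=> x; rewrite !inE.
by rewrite imset0 setC0.
Qed.

(** When [bf] orders [L], the images used up before [x] are those of its [bf]-predecessors, which
    describes the available set without recursion. *)
Lemma choice_weight_prod (bf : rel I) s L M :
  (forall x y, bf x y -> ~~ bf y x) -> pairwise bf L ->
  choice_weight s L M
  = \prod_(x <- L) w x (s x) (M :\: s @: [set y in L | bf y x]).
Proof.
move=> bfA; elim: L M => [|x L IHL] M /=; first by rewrite big_nil.
case/andP=> bfx bfL; rewrite big_cons; congr (_ * _).
  rewrite (_ : [set y in _ | _] = set0) ?imset0 ?setD0 //.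
  apply/setP=> y; rewrite !inE; apply/negbTE/negP=> /andP[/predU1P[->|Ly]].
    by move=> bxx; have := bfA _ _ bxx; rewrite bxx.
  by apply/negP/bfA/(allP bfx).
rewrite IHL //; apply: eq_big_seq => z Lz; congr (w _ _ _).
have -> : [set y in x :: L | bf y z] = x |: [set y in L | bf y z].
  apply/setP=> y; rewrite !inE; case: eqVneq => //= ->.
  by rewrite (allP bfx z Lz).
by rewrite imsetU1 setDDl.
Qed.

End SequentialChoice.

(** * Ranks in a strict total order, and one phase of choices *)

Section StrictOrder.
Variables (R : comNzRingType) (I : finType) (q : rel I).
Hypotheses (q_irr : irreflexive q) (q_tr : transitive q)
  (q_total : forall x y, x != y -> q x y || q y x).

Lemma card_around (A : {set I}) y : y \in A ->
  (#|[set z in A | q z y]| + #|[set z in A | q y z]|).+1 = #|A|.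
Proof.
move=> Ay; rewrite (cardsD1 y A) Ay add1n; congr _.+1.
rewrite -cardsUI [X in (_ + X)%N](_ : _ = 0%N).
  rewrite addn0; apply: eq_card => z; rewrite !inE -andb_orr.
  have [->|zy] := eqVneq z y; first by rewrite q_irr andbF.
  by rewrite q_total // andbT.
apply/eqP; rewrite cards_eq0 -subset0; apply/subsetP=> z; rewrite !inE.
by case/andP=> /andP[_ qzy] /andP[_ /(q_tr qzy)]; rewrite q_irr.
Qed.

(** Counting the elements of [A] beyond [y] is a bijection from [A] onto the integers below [#|A|],
    and the count before [y] is the complement to [#|A| - 1]. *)
Lemma rank_sum (A : {set I}) (v : nat -> nat -> R) :
  \sum_(y in A) v #|[set z in A | q z y]| #|[set z in A | q y z]|
  = total_weight v #|A|.
Proof.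
pose rk y := #|[set z in A | q y z]|.
have rk_lt y z : z \in A -> q y z -> (rk z < rk y)%N.
  move=> Az qyz; apply: proper_card; apply/properP; split.
    apply/subsetP=> t; rewrite !inE => /andP[-> /=]; exact: q_tr.
  by exists z; rewrite !inE Az ?q_irr ?qyz.
have rk_inj : {in A &, injective rk}.
  move=> y z Ay Az eqr; apply/eqP; apply: contraT => /q_total.
  by case/orP=> [/(rk_lt _ _ Az) | /(rk_lt _ _ Ay)]; rewrite eqr ltnn.
have rkP : perm_eq [seq rk y | y <- enum A] (index_iota 0 #|A|).
  apply: uniq_perm; rewrite ?iota_uniq //.
    rewrite map_inj_in_uniq ?enum_uniq // => y z.
    rewrite !mem_enum; exact: rk_inj.
  have sz : size [seq rk y | y <- enum A] = size (index_iota 0 #|A|).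
    by rewrite size_map size_iota -cardE subn0.
  apply: (uniq_min_size _ _ _).2; rewrite ?sz //.
    rewrite map_inj_in_uniq ?enum_uniq // => y z; rewrite !mem_enum; exact: rk_inj.
  move=> k /mapP[y]; rewrite mem_enum => Ay ->.
  by rewrite mem_index_iota /= -(card_around Ay) ltnS leq_addl.
rewrite /total_weight -(perm_big _ rkP) big_map big_enum /=; apply: eq_bigr => y Ay.
by rewrite -[in X in v X (rk y)](card_around Ay) subn1 /= addnK.
Qed.


Section Phase.
Variables (w : I -> I -> {set I} -> R) (S C D : {set I}).
Variables (v : I -> nat -> nat -> R) (u : I -> nat -> R).
Variables (L0 : seq I) (K : {set I} -> R).

(** Positions in [S] choose a target of [C] beyond themselves, the others are fixed. [D] is set
    aside for the later list [L0], whose total [K] depends only on what remains of [D]. *)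
Definition phase_weight x y (M : {set I}) : R :=
  let A := [set z in M :&: C | q x z] in
  if x \in S then
    if y \in A then v x #|[set z in A | q z y]| #|[set z in A | q y z]| else 0
  else if y == x then u x #|A| else 0.

Definition phase_total x h : R :=
  if x \in S then total_weight (v x) h else u x h.

Hypothesis CD0 : [disjoint C & D].
Hypothesis choice_sum_L0 : forall M : {set I}, choice_sum w L0 M = K (M :&: D).

Lemma choice_sum_phase (L : seq I) (M : {set I}) :
  (forall x y N, x \in L -> w x y N = phase_weight x y N) ->
  pairwise (fun x z => q z x) L ->
  (forall x, x \in L -> x \notin S -> [/\ x \notin C, x \notin D & x \in M]) ->
  choice_sum w (L ++ L0) M
  = K (M :&: D) * \prod_(x <- L)
      phase_total x (#|[set z in M :&: C | q x z]|
                     - count (fun z => (z \in S) && q x z) L).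
Proof.
elim: L M => [|x L IHL] M wE /=; first by rewrite big_nil mulr1 choice_sum_L0.
case/andP=> /allP Lx qL fixL.
have q_anti y z : q y z -> q z y = false.
  by move=> qyz; apply/negP=> /(q_tr qyz); rewrite q_irr.
have wE' y z N : y \in L -> w y z N = phase_weight y z N.
  by move=> Ly; rewrite wE // inE Ly orbT.
have cntx : count (fun z => (z \in S) && q x z) L = 0%N.
  apply/eqP; rewrite -leqn0 leqNgt -has_count; apply/hasPn=> z /Lx qzx.
  by rewrite (q_anti _ _ qzx) andbF.
rewrite big_cons q_irr andbF cntx addn0 subn0 /phase_total.
under eq_bigr => y _ do rewrite wE ?mem_head // /phase_weight.
set A := [set z in _ | q x z].
have [Sx|nSx] := ifP.
  rewrite (bigID (mem A)) /= [X in _ + X]big1 ?addr0; last first.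
    by move=> y /andP[_ /negbTE->]; rewrite mul0r.
  rewrite (eq_bigl (mem A)); last first.
    by move=> y; rewrite !inE; case: (y \in M).
  rewrite mulrCA -(rank_sum A (v x)) mulr_suml; apply: eq_bigr => y Ay.
  rewrite ifT //; congr (_ * _).
  have [My Cy qxy] : [/\ y \in M, y \in C & q x y].
    by move: Ay; rewrite /= !inE => /andP[/andP[-> ->] ->].
  have Dy : y \notin D by rewrite (disjointFr CD0).
  rewrite IHL //; last first.
    move=> z Lz nSz; have [|nCz nDz Mz] := fixL z _ nSz; first by rewrite inE Lz orbT.
    by split=> //; rewrite !inE Mz andbT; apply: contraNneq nCz => ->.
  congr (K _ * _).
    by rewrite setIDAC; apply/setDidPl; rewrite disjoint_sym disjoints1 inE (negbTE Dy) andbF.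
  rewrite !big_seq; apply: eq_bigr => z Lz; rewrite /phase_total.
  rewrite (Lx z Lz) /= subnDA.
  rewrite [in RHS](cardsD1 y) !inE My Cy (q_tr (Lx z Lz) qxy) /= add1n /=.
  have -> : [set t in (M :\ y) :&: C | q z t] = [set t in M :&: C | q z t] :\ y.
    by apply/setP=> t; rewrite !inE; case: (t == y).
  by rewrite subSS subn0.
have [nCx nDx Mx] := fixL x (mem_head x L) (negbT nSx).
rewrite (bigD1 x) //= eqxx big1 ?addr0; last first.
  by move=> y /andP[_ /negbTE->]; rewrite mul0r.
rewrite mulrCA; congr (_ * _); rewrite IHL //; last first.
  move=> z Lz nSz; have [|nCz nDz Mz] := fixL z _ nSz; first by rewrite inE Lz orbT.
  split=> //; rewrite !inE Mz andbT; apply: contraTneq (Lx z Lz) => ->.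
  by rewrite q_irr.
congr (K _ * _).
  by rewrite setIDAC; apply/setDidPl; rewrite disjoint_sym disjoints1 inE (negbTE nDx) andbF.
rewrite !big_seq; apply: eq_bigr => z Lz; rewrite /= add0n.
rewrite (_ : (M :\ x) :&: C = M :&: C) //.
by rewrite setIDAC; apply/setDidPl; rewrite disjoint_sym disjoints1 inE (negbTE nCx) andbF.
Qed.

End Phase.

End StrictOrder.

(** * Power series products and recurrences for truncated fractions *)

Section PowerSeries.
Variable R : comNzRingType.
Implicit Types (u v w : fps R) (x : R).

(** Transfers products to polynomials, whose ring laws give commutativity and associativity. *)
Lemma fps_mul_coef N u v n : (n < N)%N ->
  fps_mul u v n = ((\poly_(i < N) u i) * (\poly_(i < N) v i))`_n.
Proof.
move=> ltnN; rewrite coefM; apply: eq_bigr => i _.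
have lei : (i <= n)%N by rewrite -ltnS.
by rewrite !coef_poly (leq_ltn_trans lei) // (leq_ltn_trans (leq_subr _ _)).
Qed.

Lemma fps_mulC u v : fps_mul u v = fps_mul v u.
Proof.
by apply: functional_extensionality => n; rewrite !(@fps_mul_coef n.+1) // mulrC.
Qed.

Lemma fps_mulA u v w : fps_mul u (fps_mul v w) = fps_mul (fps_mul u v) w.
Proof.
pose p N (z : fps R) := \poly_(i < N) z i.
have assoc (x y z : fps R) n : fps_mul x (fps_mul y z) n = (p n.+1 x * (p n.+1 y * p n.+1 z))`_n.
  rewrite coefM; apply: eq_bigr => i _; rewrite coef_poly ltn_ord.
  by rewrite (@fps_mul_coef n.+1) // ltnS leq_subr.
apply: functional_extensionality => n.
by rewrite (fps_mulC (fps_mul u v) w) !assoc mulrA [in RHS]mulrC.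
Qed.

Lemma fps_mul1 u : fps_mul (@fps1 R) u = u.
Proof.
apply: functional_extensionality => n; rewrite /fps_mul big_ord_recl /=.
by rewrite mul1r subn0 big1 ?addr0 // => i _; rewrite mul0r.
Qed.

Lemma fps_mulBl u v w n :
  fps_mul (fps_sub u v) w n = fps_mul u w n - fps_mul v w n.
Proof.
by rewrite /fps_mul -sumrB; apply: eq_bigr => i _; rewrite mulrBl.
Qed.

Lemma fps_mulZr x u v n : fps_mul u (fps_scale x v) n = x * fps_mul u v n.
Proof. by rewrite /fps_mul mulr_sumr; apply: eq_bigr => i _; rewrite mulrCA. Qed.

Definition fps_shift u : fps R := fun n => if n is n'.+1 then u n' else 0.

Lemma fps_mul_0 u v : fps_mul u v 0%N = u 0%N * v 0%N.
Proof. by rewrite /fps_mul big_ord_recl big_ord0 addr0. Qed.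

Lemma fps_mul_shift u v n : fps_mul u (fps_shift v) n.+1 = fps_mul u v n.
Proof.
rewrite /fps_mul big_ord_recr /= subnn mulr0 addr0; apply: eq_bigr => i _.
by rewrite subSn // -ltnS.
Qed.

Lemma fps_mulZX x u n :
  fps_mul (fps_scale x (@fpsX R)) u n = if n is n'.+1 then x * u n' else 0.
Proof.
have XE : @fpsX R = fps_shift (@fps1 R).
  by apply: functional_extensionality => -[].
rewrite fps_mulC fps_mulZr XE; case: n => [|n]; last by rewrite fps_mul_shift fps_mulC fps_mul1.
by rewrite fps_mul_0 !mulr0.
Qed.

Variables alpha delta : nat -> R.
Local Notation T := (tfrac_trunc alpha delta).

Lemma tfrac_trunc0 N k : T N.+1 k 0%N = 1.
Proof.
by rewrite /= /fps_inv big_ord_recl big_ord0 addr0.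
Qed.

(** Clearing the denominator gives [T = 1 + delta t T + alpha t T' T] with [T'] the next tail; this
    is its coefficient [n.+1]. *)
Lemma tfrac_truncS N k n :
  T N.+1 k n.+1 = delta k * T N.+1 k n + alpha k * fps_mul (T N k.+1) (T N.+1 k) n.
Proof.
set u := fps_sub (fps_sub (@fps1 R) (fps_scale (delta k) (@fpsX R)))
  (fps_mul (fps_scale (alpha k) (@fpsX R)) (T N k.+1)).
have u0 : u 0%N = 1.
  by rewrite /u /fps_sub /fps_scale fps_mulZX /= mulr0 !subr0.
have := fps_mulfV u0 n.+1; rewrite -/(T N.+1 k) !fps_mulBl fps_mul1.
rewrite -fps_mulA !fps_mulZX -addrA -opprD => /eqP.
by rewrite subr_eq0 => /eqP.
Qed.

Lemma tfrac_trunc_mulS N k v n :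
  fps_mul (T N.+1 k) v n.+1
  = v n.+1 + delta k * fps_mul (T N.+1 k) v n
    + alpha k * fps_mul (T N k.+1) (fps_mul (T N.+1 k) v) n.
Proof.
rewrite fps_mulA [in LHS]/fps_mul big_ord_recl tfrac_trunc0 mul1r subn0 -addrA.
congr (_ + _); rewrite /fps_mul !mulr_sumr -big_split /=; apply: eq_bigr => i _.
by rewrite -/(T N.+1 k) tfrac_truncS mulrDl -!mulrA.
Qed.

End PowerSeries.

(** * Alternating paths and the continued fraction *)

Section ContinuedFraction.
Variables (R : comNzRingType) (A B E F : nat -> R) (alpha delta : nat -> R).

(** In Dyck levels, an odd step goes from [2h] up to [2h+1] ([A]) or down to [2h-1] ([F]), an even
    step from [2h-1] down to [2h-2] ([B]) or up to [2h] ([E]). Two level steps at height 0 would dip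
    below level 0; they account for [delta 1]. *)
Definition odd_step (g : nat -> R) h := A h.+1 * g h.+1 + F h * g h.
(** The truncated [h.-1] at height 0 is harmless under the hypothesis [B 0 = 0]. *)
Definition even_step (g : nat -> R) h := B h * g h.-1 + E h * g h.

(* Weight of the paths of n odd steps (up, or level) alternating with n even
   steps (down, or level) that lead from height h to height 0. *)
Fixpoint path_sum n h : R :=
  if n is n'.+1 then odd_step (even_step (path_sum n')) h else (h == 0%N)%:R.

Hypothesis alpha_odd : forall h, alpha (2 * h).+1 = A h.+1 * B h.+1.
Hypothesis alpha_even : forall h, alpha (2 * h.+1)%N = E h.+1 * F h.+1.
Hypothesis delta1 : delta 1%N = E 0%N * F 0%N.
Hypothesis delta_ge2 : forall k, (2 <= k)%N -> delta k = 0.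
Hypothesis B0 : B 0%N = 0.

Section Truncation.
Variable N : nat.
(** With this number of levels all the [U k] are tails of the single truncation [U 1]. *)
Let U k := tfrac_trunc alpha delta (N.+1 - k) k.

Let U_mul0 k v : (k <= N)%N -> fps_mul (U k) v 0%N = v 0%N.
Proof. by move=> lek; rewrite fps_mul_0 /U subSn // tfrac_trunc0 mul1r. Qed.

Let U_mulS k v n : (k <= N)%N ->
  fps_mul (U k) v n.+1
  = v n.+1 + delta k * fps_mul (U k) v n
    + alpha k * fps_mul (U k.+1) (fps_mul (U k) v) n.
Proof. by move=> lek; rewrite /U subSS subSn // tfrac_trunc_mulS. Qed.

(* Height h is level 2h of the Dyck paths enumerated by the fraction.  A path from
   there to level 0 alternates excursions, enumerated by the U k, and its first
   descents below each of the levels 2h, .., 1. *)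
Fixpoint height_series h : fps R :=
  if h is h'.+1 then
    fps_scale (F h * B h)
      (fps_shift (fps_mul (U (2 * h).+1) (fps_mul (U (2 * h)%N) (height_series h'))))
  else U 1.

(** Unfolding the excursions [U (2 * h.+1)] above level [2h+1] separates the paths that descend at
    once, with [B], from those that rise with [E] and later return with [F]. *)
Lemma even_step_height_series h n : (2 * h.+1 <= N)%N ->
  even_step (height_series^~ n) h.+1
  = B h.+1 * fps_mul (U (2 * h.+1)) (height_series h) n.
Proof.
move=> leN; rewrite /even_step [height_series h.+1]/= /fps_scale.
case: n => [|n]; first by rewrite U_mul0 // !mulr0 addr0.
rewrite U_mulS // delta_ge2 ?leq_pmulr // mul0r addr0 alpha_even mulrDr /=.
by congr (_ + _); ring.
Qed.

Lemma height_seriesS h n : (2 * h.+1 <= N)%N ->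
  height_series h n.+1 = odd_step (even_step (height_series^~ n)) h.
Proof.
move=> leN; rewrite /odd_step even_step_height_series //.
case: h leN => [|h] leN.
  (* At height 0 no descent is possible, and the equation of [U 1] supplies the pair of level steps
     through [delta 1]. *)
  rewrite /even_step B0 /= /U subn1 /= -[N]prednK ?(leq_trans _ leN) //.
  rewrite tfrac_truncS delta1 (alpha_odd 0) prednK ?(leq_trans _ leN) //.
  rewrite subSS subn1; ring.
have leN' : (2 * h.+1 <= N)%N by apply: leq_trans leN; rewrite leq_mul2l /= ltnW.
rewrite even_step_height_series // [in LHS]/= /fps_scale.
set V := fps_mul (U (2 * h.+1)) _.
have ltN : ((2 * h.+1).+1 <= N)%N by apply: leq_trans leN; rewrite !mulnS !addnA.
case: n => [|n].
  rewrite /= !U_mul0 // /fps_scale /= mulr0 mulr0. ring.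
rewrite /= U_mulS // delta_ge2 // alpha_odd /= fps_mulZr fps_mul_shift -/V.
rewrite (_ : (2 * h.+1).+2 = (2 * h.+2)%N); last by rewrite !mulnS.
ring.
Qed.

(** Such paths stay at heights at most [n + h], too low to meet the truncation. *)
Lemma height_series_path_sum n h : (0 < N)%N -> (2 * (n + h) <= N)%N ->
  height_series h n = path_sum n h.
Proof.
move=> N0; elim: n h => [|n IHn] h leN.
  case: h leN => [|h] _; last by rewrite /= /fps_scale /= mulr0.
  by rewrite /= /U subSS subn0 -(prednK N0) tfrac_trunc0.
have le_h : (2 * h.+1 <= N)%N.
  by apply: leq_trans leN; rewrite leq_mul2l /= addSn ltnS leq_addl.
rewrite height_seriesS //= /odd_step /even_step.
by rewrite !IHn //=; apply: leq_trans leN; rewrite leq_mul2l /= addSn ?addnS // ltnW // ltnS leq_add2l leq_pred.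
Qed.

End Truncation.

Lemma path_sum_tfraction : is_tfraction alpha delta (path_sum^~ 0%N).
Proof.
(* The successor keeps the truncation nonempty when [n] is 0. *)
move=> n; exists (2 * n).+1 => N ltN.
rewrite -(@height_series_path_sum N) ?addn0 ?(leq_trans _ ltN) //.
by rewrite /= subSS subn0.
Qed.

End ContinuedFraction.

Lemma pairwise_rev (T : Type) (r : rel T) (t : seq T) :
  pairwise r (rev t) = pairwise (fun x y => r y x) t.
Proof.
by elim: t => //= x t IHt; rewrite rev_cons pairwise_rcons all_rev IHt.
Qed.

(** * Crossings and nestings as counts of single arcs *)

Section ArcCounts.
Variables (m : nat) (s : 'S_m).
Implicit Types i j k l : 'I_m.

(** As in the three lemmas that follow, one entry of a triple determines the two others. *)
Lemma ucrossE j :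
  ucross j s = #|[set i : 'I_m | [&& (i < j)%N, (j < s i)%N & (s i < s j)%N]]|.
Proof.
rewrite -(card_imset (f := fun i => (i, s i, s j))); last by move=> i k [].
apply: eq_card => -[[i k] l]; rewrite !inE; apply/idP/imsetP.
  case/and5P=> ij jk kl /eqP ki /eqP lj; exists i; rewrite ?ki ?lj //.
  by rewrite inE ij -ki -lj jk kl.
by case=> i'; rewrite inE => /and3P[? ? ?] [-> -> ->]; apply/and5P; split.
Qed.

Lemma unestE j : (j < s j)%N ->
  unest j s = #|[set i : 'I_m | (i < j)%N && (s j < s i)%N]|.
Proof.
move=> js; rewrite -(card_imset (f := fun i => (i, s j, s i))); last by move=> i k [].
apply: eq_card => -[[i k] l]; rewrite !inE; apply/idP/imsetP.
  case/and5P=> ij jk kl /eqP ki /eqP lj; exists i; rewrite ?ki ?lj //.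
  by rewrite inE ij -ki -lj kl.
by case=> i'; rewrite inE => /andP[? ?] [-> -> ->]; apply/and5P; split.
Qed.

Lemma lcrossE k :
  lcross k s = #|[set l : 'I_m | [&& (k < l)%N, (s k < s l)%N & (s l < k)%N]]|.
Proof.
rewrite -(card_imset (f := fun l => (s k, s l, l))); last by move=> i j [].
apply: eq_card => -[[i j] l]; rewrite !inE; apply/idP/imsetP.
  case/and5P=> ij jk kl /eqP ki /eqP lj; exists l; rewrite ?ki ?lj //.
  by rewrite inE kl -ki -lj ij jk.
by case=> i'; rewrite inE => /and3P[? ? ?] [-> -> ->]; apply/and5P; split.
Qed.

Lemma lnestE k : (s k < k)%N ->
  lnest k s = #|[set l : 'I_m | (k < l)%N && (s l < s k)%N]|.
Proof.
move=> sk; rewrite -(card_imset (f := fun l => (s l, s k, l))); last by move=> i j [].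
apply: eq_card => -[[i j] l]; rewrite !inE; apply/idP/imsetP.
  case/and5P=> ij jk kl /eqP ki /eqP lj; exists l; rewrite ?ki ?lj //.
  by rewrite inE kl -ki -lj ij.
by case=> i'; rewrite inE => /andP[? ?] [-> -> ->]; apply/and5P; split.
Qed.

End ArcCounts.

(* p and q count the sources and the targets of upper arcs before i, so that
   p - q is the height (truncated to 0, which makes the weights of the descents
   vanish, if the path would become negative). *)
Definition step_weight (R : comNzRingType) (a b c d : nat -> nat -> R)
    (e f : nat -> R) (i : nat) (t : option bool) (p q : nat) : R :=
  if t is Some t1 then
    if odd i then total_weight (if t1 then b else c) (p - q)
    else total_weight (if t1 then d else a) (p.+1 - (q + t1))
  else (if odd i then e else f) (p - q)%N.

(** * Permutations of a fixed type *)

Section FixedType.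
Variables (R : comNzRingType) (a b c d : nat -> nat -> R) (e f : nat -> R).
Variables (m : nat) (tau : 'I_m -> option bool).
Implicit Types (s : 'S_m) (x y z : 'I_m).

(* None: fixed point; Some true: the arc into x starts on the left of x;
   Some false: it starts on the right of x. *)
Definition arc_type s x : option bool :=
  if s x == x then None else Some ((s^-1)%g x < x)%N.

Definition is_Dperm s :=
  [forall x : 'I_m, if odd x.+1 then (x <= s x)%N else (s x <= x)%N].

(** An odd index is an even label, where the arc leaves to the left. The side of the preimage, read
    from [tau], separates peaks from double falls there, and double rises from valleys at even
    indices. *)
Definition arc_weight s x : R :=
  if s x == x then (if odd x then e else f) (psnest x s)
  else if odd x
    then (if tau x == Some true then b else c) (lcross x s) (lnest x s)
    else (if tau x == Some true then d else a) (ucross x s) (unest x s).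

(** Fixed points of both parities join the upper phase, since [psnest] counts the upper arcs above
    them. *)
Let upper x := ~~ odd x || (tau x == None).
Let S1 := [set x : 'I_m | ~~ odd x && (tau x != None)].
Let S2 := [set x : 'I_m | odd x && (tau x != None)].
Let T1 := [set x : 'I_m | tau x == Some true].
Let T2 := [set x : 'I_m | tau x == Some false].
Let lt1 : rel 'I_m := fun x y => (x < y)%N.
Let lt2 : rel 'I_m := fun x y => (y < x)%N.

(* The targets of the upper arcs are chosen from right to left and those of
   the lower arcs from left to right: the crossings and nestings counted at x
   then only depend on the targets that are still available. *)
Let w x y (M : {set 'I_m}) : R :=
  if upper x then
    phase_weight lt1 S1 T1 (fun x => if tau x == Some true then d else a)
      (fun x => if odd x then e else f) x y M
  else phase_weight lt2 S2 T2 (fun x => if tau x == Some true then b else c)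
      (fun _ _ => 0) x y M.

Let before y x : bool :=
  if upper y then upper x ==> (x < y)%N else ~~ upper x && (y < x)%N.
Let L1 := rev [seq x <- enum 'I_m | upper x].
Let L2 := [seq x <- enum 'I_m | ~~ upper x].

(** The condition outside which [w] takes its default value 0. *)
Let allowed s x :=
  if upper x then
    if x \in S1 then (s x \in T1) && (x < s x)%N else s x == x
  else (s x \in T2) && (s x < x)%N.

Let upperS1 x : x \in S1 -> upper x.
Proof. by rewrite inE /upper => /andP[->]. Qed.

Let nupperS2 x : ~~ upper x = (x \in S2).
Proof. by rewrite inE /upper negb_or negbK. Qed.

(** The inequality at [x] comes from [allowed] at [x], the type at [x] from [allowed] at its
    preimage. *)
Lemma allowed_arc_type s :
  [forall x, allowed s x] = is_Dperm s && [forall x, arc_type s x == tau x].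
Proof.
apply/forallP/andP => [ok | [/forallP Ds /forallP ty] x].
  split; apply/forallP=> x; have := ok x; rewrite /allowed /upper !inE.
    rewrite /= if_neg. 
    case: (odd x) => /=; case: (tau x) => [t|] /=.
    - by case/andP=> _ /ltnW.
    - by move/eqP->.
    - by case/andP=> _ /ltnW.
    - by move/eqP->.
  rewrite /arc_type; have := ok ((s^-1)%g x); rewrite /allowed /upper !inE permKV.
  case tx: (tau x) => [t|] /=; last first.
    by rewrite orbT andbF => _ /eqP ->; rewrite eqxx.
  rewrite orbF andbT => h sx.
  have -> : (s x == x) = false.
    by apply/eqP=> sxx; move: sx; rewrite sxx; case: (odd x) => /=; rewrite ltnn andbF.
  move: h; have [ty|ty] := eqVneq (tau ((s^-1)%g x)) None.
    rewrite orbT andbF => /eqP xs; move: sx; rewrite [in s x]xs permKV.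
    by case: (odd x) => /=; rewrite ltnn andbF.
  rewrite andbT orbF; case: (odd _) => /= /andP[/eqP[->]] // lt.
    by rewrite ltnNge ltnW.
  by rewrite lt.
have := Ds x; rewrite /allowed /upper !inE -!(eqP (ty _)) /arc_type /= permK.
rewrite (inj_eq perm_inj) if_neg; have [->|nsx] := eqVneq (s x) x; first by rewrite orbT andbF.
rewrite orbF andbT; case: (odd x) => /= le.
  have lt : (s x < x)%N by rewrite ltn_neqAle le andbT.
  by rewrite lt ltnNge ltnW.
by have -> : (x < s x)%N by rewrite ltn_neqAle eq_sym le andbT.
Qed.

Section Allowed.
Variable s : 'S_m.
Hypothesis ok : forall x, allowed s x.

Let okD : is_Dperm s && [forall x, arc_type s x == tau x].
Proof. by rewrite -allowed_arc_type; apply/forallP. Qed.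

Let tauE x : tau x = arc_type s x.
Proof. by apply/esym/eqP; case/andP: okD => _ /forallP. Qed.

Let availE x : ~: s @: [set y | before y x] = [set z | ~~ before ((s^-1)%g z) x].
Proof.
apply/setP=> z; rewrite !inE -{1}(permKV s z) mem_imset ?inE //; exact: perm_inj.
Qed.

(** The images used so far come from upper positions right of [x], so a target in [T1] beyond [x] is
    free exactly when its arc starts at [x] or passes over it. *)
Lemma upper_avail x : upper x ->
  [set z in (~: s @: [set y | before y x]) :&: T1 | lt1 x z]
  = s @: [set i : 'I_m | (i <= x)%N && (x < s i)%N].
Proof.
move=> ux; rewrite availE; apply/setP=> z; rewrite -(permKV s z).
set i := (s^-1)%g z; rewrite mem_imset ?inE ?permK; last exact: perm_inj.
rewrite /lt1 andbC [in RHS]andbC; case: ltnP => //= xsi.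
rewrite tauE /arc_type permK (inj_eq perm_inj) /before ux /= /upper.
rewrite [tau i]tauE /arc_type.
have := ok i; have := forallP (andP okD).1 i; rewrite /= if_neg.
have [sii|nsi] := eqVneq (s i) i.
  by rewrite orbT /= -leqNgt sii andbF; move: xsi; rewrite sii ltnNge => /negbTE->.
rewrite orbF; case: (odd i) => /= le _.
  rewrite (_ : (i < s i)%N = false) ?andbF; last by rewrite ltnNge le.
  by apply/esym/negbTE; rewrite -ltnNge (leq_trans xsi).
rewrite -leqNgt (_ : (i < s i)%N) ?andbT //.
by rewrite ltn_neqAle eq_sym nsi.
Qed.

Lemma lower_avail x : ~~ upper x ->
  [set z in (~: s @: [set y | before y x]) :&: T2 | lt2 x z]
  = s @: [set i : 'I_m | (x <= i)%N && (s i < x)%N].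
Proof.
move=> ux; rewrite availE; apply/setP=> z; rewrite -(permKV s z).
set i := (s^-1)%g z; rewrite mem_imset ?inE ?permK; last exact: perm_inj.
rewrite /lt2 andbC [in RHS]andbC; case: ltnP => //= xsi.
rewrite tauE /arc_type permK (inj_eq perm_inj) /before (negbTE ux) /= /upper.
rewrite [tau i]tauE /arc_type.
have := forallP (andP okD).1 i; rewrite /= if_neg.
have [sii|nsi] := eqVneq (s i) i.
  by rewrite orbT /= => _; move: xsi; rewrite sii ltnNge => /negbTE->.
rewrite orbF; case: (odd i) => /= le.
  by rewrite -leqNgt ltnNge le andbT.
apply/esym/negbTE; rewrite -ltnNge (leq_ltn_trans le) //.
Qed.

(** Among the free targets, those between [x] and [s x] end arcs crossing that of [x], those beyond
    [s x] end arcs nesting it; at a fixed point all of them count for [psnest]. *)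
Lemma allowed_weight x :
  w x (s x) (~: s @: [set y | before y x]) = arc_weight s x.
Proof.
rewrite /w /phase_weight /arc_weight.
have := ok x; rewrite /allowed.
have [ux|nux] := boolP (upper x).
  rewrite upper_avail //; have [S1x /andP[T1s ltxs]|nS1x /eqP sxx] := ifP.
    rewrite (mem_imset _ _ (@perm_inj _ s)).
    rewrite inE leqnn ltxs /=.
    have -> : (s x == x) = false by apply/negbTE; rewrite neq_ltn ltxs orbT.
    have -> : odd x = false by move: S1x; rewrite inE => /andP[/negbTE].
    rewrite ucrossE unestE //; set g := (if tau x == _ then _ else _); congr (g _ _); 
      rewrite -[RHS](card_imset _ (@perm_inj _ s)); apply: eq_card => z;
      rewrite -(permKV s z) !inE !(mem_imset _ _ (@perm_inj _ s));
      rewrite !inE /lt1.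
      (* The free targets include [s x] itself, which the strict comparison with [s x] discards. *)
      have [->|] := eqVneq ((s^-1)%g z) x; first by rewrite ltnn leqnn !andbF.
      rewrite (leq_eqVlt _ x) => /negbTE ne; rewrite [_ == _ :> nat]ne /=.
      by rewrite -andbA.
    have [->|] := eqVneq ((s^-1)%g z) x; first by rewrite !ltnn !andbF.
    rewrite (leq_eqVlt _ x) => /negbTE ne; rewrite [_ == _ :> nat]ne /=.
    case: ltnP => //= _. case: (ltnP (s x)) => // h; rewrite ?andbF ?andbT //.
    exact: ltn_trans h.
  rewrite sxx eqxx; congr ((if _ then _ else _) _).
  rewrite /psnest card_imset; last exact: perm_inj.
  apply: eq_card => i; rewrite !inE; have [->|] := eqVneq i x.
    by rewrite sxx ltnn andbF.
  by rewrite (leq_eqVlt _ x) => /negbTE ne; rewrite [_ == _ :> nat]ne.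
case/andP=> T2s ltsx; move: (nux); rewrite nupperS2 => S2x; rewrite S2x.
rewrite lower_avail // (mem_imset _ _ (@perm_inj _ s)).
rewrite inE leqnn ltsx /=.
have -> : (s x == x) = false by apply/negbTE; rewrite neq_ltn ltsx.
have -> : odd x by move: S2x; rewrite inE => /andP[].
rewrite lcrossE lnestE //; set g := (if tau x == _ then _ else _); congr (g _ _);
  rewrite -[RHS](card_imset _ (@perm_inj _ s)); apply: eq_card => z;
  rewrite -(permKV s z) !inE !(mem_imset _ _ (@perm_inj _ s));
  rewrite !inE /lt2.
  have [->|] := eqVneq ((s^-1)%g z) x; first by rewrite !ltnn !andbF.
  rewrite (leq_eqVlt x) eq_sym => /negbTE ne; rewrite [_ == _ :> nat]ne /=.
  by rewrite -andbA [in RHS](andbC (s x < _)%N).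
have [->|] := eqVneq ((s^-1)%g z) x; first by rewrite !ltnn !andbF.
rewrite (leq_eqVlt x) eq_sym => /negbTE ne; rewrite [_ == _ :> nat]ne /=.
case: ltnP => //= _. case: (ltnP _ (s x)) => // h; rewrite ?andbF ?andbT //.
exact: ltn_trans ltsx.
Qed.

End Allowed.

Lemma not_allowed_weight s x M : ~~ allowed s x -> w x (s x) M = 0.
Proof.
rewrite /allowed /w /phase_weight; have [ux|nux] := boolP (upper x).
  have [S1x|nS1x /negbTE-> //] := ifP.
  by rewrite negb_and !inE /lt1 => /orP[]/negbTE->; rewrite ?andbF.
rewrite -nupperS2 nux negb_and !inE /lt2 => /orP[]/negbTE->; rewrite ?andbF //.
Qed.


Let before_asym x y : before x y -> ~~ before y x.
Proof.
by rewrite /before; case: (upper x); case: (upper y) => //= /ltnW; rewrite leqNgt.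
Qed.

Let pairwise_enum : pairwise lt1 (enum 'I_m).
Proof.
have <- := pairwise_map (@nat_of_ord m) ltn (enum 'I_m); rewrite val_enum_ord.
by rewrite -sorted_pairwise ?iota_ltn_sorted //; exact: ltn_trans.
Qed.

Let pairwise_L2 : pairwise (fun x y => lt2 y x) L2.
Proof. exact: pairwise_filter. Qed.

Let pairwise_L1 : pairwise (fun x y => lt1 y x) L1.
Proof. by rewrite pairwise_rev; exact: pairwise_filter. Qed.

Let pairwise_L : pairwise before (L1 ++ L2).
Proof.
rewrite pairwise_cat; apply/and3P; split.
- apply/allrelP=> x y; rewrite mem_rev !mem_filter => /andP[ux _] /andP[uy _].
  by rewrite /before ux (negbTE uy).
- apply: (sub_in_pairwise (P := [pred x | upper x])) pairwise_L1.
    by move=> x y; rewrite !inE /before => -> ->.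
  by apply/allP=> x; rewrite mem_rev mem_filter => /andP[].
- apply: (sub_in_pairwise (P := [pred x | ~~ upper x])) pairwise_L2.
    by move=> x y; rewrite !inE /before => /negbTE-> /negbTE->.
  by apply/allP=> x; rewrite mem_filter => /andP[].
Qed.

Let mem_L x : x \in L1 ++ L2.
Proof. by rewrite mem_cat mem_rev !(mem_filter _ _ (enum 'I_m)) !mem_enum !andbT orbN. Qed.

Let uniq_L : uniq (L1 ++ L2).
Proof.
apply: (@pairwise_uniq _ before) pairwise_L => x; apply/negbTE/negP => bxx.
by have := before_asym bxx; rewrite bxx.
Qed.

(** Other permutations have a factor 0, so the sum extends to all of them. *)
Lemma sum_allowed_choice_sum :
  \sum_(s | is_Dperm s && [forall x, arc_type s x == tau x]) \prod_x arc_weight s x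
  = choice_sum w (L1 ++ L2) setT.
Proof.
rewrite -sum_choice_weight // (eq_bigl (fun s => [forall x, allowed s x])); last first.
  by move=> s; rewrite allowed_arc_type.
rewrite big_mkcond; apply: eq_bigr => s _.
rewrite (choice_weight_prod _ _ _ before_asym pairwise_L).
have permL : perm_eq (index_enum 'I_m) (L1 ++ L2).
  by apply: uniq_perm; rewrite ?index_enum_uniq // => x; rewrite mem_L mem_index_enum.
rewrite -(perm_big _ permL) /=.
case: forallP => [ok | /forallP]; last first.
  case/forallPn => x nok; rewrite (bigD1 x) //= (not_allowed_weight _ nok) mul0r //.
apply: eq_bigr => x _; rewrite -(allowed_weight ok); rewrite setTD.
have -> // : [set y in L1 ++ L2 | before y x] = [set y | before y x].
by apply/setP=> y; rewrite [LHS]inE [RHS]inE mem_L.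
Qed.

Let p k := #|[set y : 'I_m | (y < k)%N && (y \in S1)]|.
Let q k := #|[set y : 'I_m | (y < k)%N && (y \in T1)]|.

Let count_enum (P : pred 'I_m) : count P (enum 'I_m) = #|[set x | P x]|.
Proof. by rewrite cardsE cardE -size_filter; congr size; rewrite {2}/enum_mem -enumT. Qed.

Let card_split (P : {set 'I_m}) x :
  #|P| = (#|[set y : 'I_m | (y < x)%N && (y \in P)]| + (x \in P)
          + #|[set y : 'I_m | (x < y)%N && (y \in P)]|)%N.
Proof.
rewrite (cardsD1 x P) addnAC addnC; congr (_ + _)%N.
rewrite -cardsUI [X in (_ + X)%N](_ : _ = 0%N).
  rewrite addn0; apply: eq_card => y; rewrite !inE -andb_orl -neq_ltn //.
apply/eqP; rewrite cards_eq0 -subset0; apply/subsetP=> y; rewrite !inE.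
by case/andP=> /andP[lt _] /andP[]; rewrite ltnNge ltnW.
Qed.

(** Both sides count the non-fixed positions before [k], sorted by incoming arc on the left and by
    outgoing arc on the right. *)
Let card_nonfixed k :
  (q k + #|[set y : 'I_m | (y < k)%N && (y \in T2)]| =
   p k + #|[set y : 'I_m | (y < k)%N && (y \in S2)]|)%N.
Proof.
rewrite /p /q -[LHS]cardsUI -[RHS]cardsUI.
by congr (_ + _)%N; apply: eq_card => y; rewrite !inE; case: (_ < _)%N => //=;
  case: (odd y); case: (tau y) => [[]|].
Qed.

(** Two uses of [choice_sum_phase], the lower phase serving as continuation of the upper one. The
    upper phase counts targets minus sources right of [x], which [#|S1| = #|T1|] converts into
    counts on the left; [card_nonfixed] converts the lower ones. *)
Lemma choice_sum_step_weight : #|S1| = #|T1| ->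
  choice_sum w (L1 ++ L2) setT
  = \prod_(x < m) step_weight a b c d e f x (tau x) (p x) (q x).
Proof.
move=> eqST.
pose v2 x := if tau x == Some true then b else c.
pose W2 (N : {set 'I_m}) x := phase_total S2 v2 (fun _ _ => 0) x
  (#|[set z in N | lt2 x z]| - count (fun z => (z \in S2) && lt2 x z) L2).
have phase2 M : choice_sum w L2 M = \prod_(x <- L2) W2 (M :&: T2) x.
  have := @choice_sum_phase R _ lt2 _ _ _ w S2 T2 set0 v2 (fun _ _ => 0) [::] (fun=> 1)
    _ _ L2 M; rewrite cats0 mul1r; apply => //.
  - by move=> x; exact: ltnn.
  - by move=> y x z /= h1 h2; exact: ltn_trans h2 h1.
  - by move=> x y; rewrite neq_ltn orbC.
  - by rewrite -setI_eq0 setI0.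
  - by move=> x y N; rewrite mem_filter /w => /andP[/negbTE->].
  - by move=> x; rewrite mem_filter nupperS2 => /andP[->].
rewrite (@choice_sum_phase R _ lt1 _ _ _ w S1 T1 T2 
  (fun x => if tau x == Some true then d else a) (fun x => if odd x then e else f)
  L2 (fun N => \prod_(x <- L2) W2 N x)) //; first last.
- move=> x; rewrite mem_rev mem_filter => /andP[ux _]; rewrite !inE.
  by move: ux; rewrite /upper; case: (odd x); case: (tau x).
- by move=> x y N; rewrite mem_rev mem_filter /w => /andP[->].
- rewrite -setI_eq0; apply/eqP/setP=> x; rewrite !inE.
  by case: (tau x) => [[]|].
- by move=> x y; rewrite neq_ltn.
- by move=> y x z; exact: ltn_trans.
- by move=> x; exact: ltnn.
have permL : perm_eq (index_enum 'I_m) (L1 ++ L2).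
  by apply: uniq_perm; rewrite ?index_enum_uniq // => x; rewrite mem_L mem_index_enum.
rewrite (perm_big _ permL) /= big_cat mulrC /=; congr (_ * _).
  rewrite !big_seq; apply: eq_bigr => x; rewrite mem_rev mem_filter => /andP[ux _].
  have -> : count (fun z => (z \in S1) && lt1 x z) L1 =
            #|[set z : 'I_m | (x < z)%N && (z \in S1)]|.
    rewrite -count_enum /L1 count_rev count_filter; apply: eq_count => z /=.
    by rewrite andbC andbA andbC /lt1; case: (boolP (z \in S1)) => [/upperS1->|]; rewrite ?andbF ?andbT.
  rewrite setTI (_ : [set z in T1 | lt1 x z] = [set z : 'I_m | (x < z)%N && (z \in T1)]); last first.
    by apply/setP=> z; rewrite [LHS]inE [RHS]inE andbC.
  move: eqST; rewrite (card_split S1 x) (card_split T1 x) -/(p x) -/(q x).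
  move: #|_| #|_| => t1 s1; rewrite /phase_total /step_weight.
  case tx: (tau x) => [t|]; last first.
    rewrite !inE tx andbF !addn0 => eqST; congr ((if _ then _ else _) _); lia.
  have nox : odd x = false by move: ux; rewrite /upper tx orbF => /negbTE.
  rewrite !inE tx nox /= => eqST.
  (* [x] is itself a source, hence [.+1], and a target when [t] is true. *)
  have -> : (t1 - s1 = (p x).+1 - (q x + t))%N.
    by clear tx; case: t eqST => /=; lia.
  by case: t tx eqST.
rewrite !big_seq; apply: eq_bigr => x; rewrite mem_filter => /andP[nux _].
rewrite /W2.
have -> : count (fun z => (z \in S2) && lt2 x z) L2 =
          #|[set z : 'I_m | (z < x)%N && (z \in S2)]|.
  rewrite -count_enum /L2 count_filter; apply: eq_count => z /=.
  by rewrite nupperS2 andbC andbA andbb andbC.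
rewrite setTI (_ : [set z in T2 | lt2 x z] = [set z : 'I_m | (z < x)%N && (z \in T2)]); last first.
  by apply/setP=> z; rewrite [LHS]inE [RHS]inE andbC.
have := card_nonfixed x; move: #|_| #|_| => s2 t2 eqpq.
have -> : (t2 - s2 = p x - q x)%N by lia.
move: nux; rewrite nupperS2 /phase_total => S2x; rewrite S2x /step_weight.
move: S2x; rewrite inE /v2; case: (tau x) => [t|]; last by rewrite andbF.
by rewrite andbT => ->; case: t.
Qed.

(** A permutation of type [tau] in D maps [S1] onto [T1], so none exists when the cardinals
    differ. *)
Lemma sum_arc_type :
  \sum_(s | is_Dperm s && [forall x, arc_type s x == tau x]) \prod_x arc_weight s x
  = (#|S1| == #|T1|)%:R
    * \prod_(x < m) step_weight a b c d e f x (tau x) (p x) (q x).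
Proof.
have [eqST|neST] := eqVneq; first by rewrite mul1r sum_allowed_choice_sum choice_sum_step_weight.
rewrite mul0r big_pred0 // => s; apply/negbTE; apply: contra_neqN neST.
case/andP=> /forallP Ds /forallP ty; rewrite -(card_imset _ (@perm_inj _ s)).
apply: eq_card => z; rewrite -(permKV s z) (mem_imset _ _ (@perm_inj _ s)).
set i := (s^-1)%g z; rewrite !inE -!(eqP (ty _)) /arc_type permK (inj_eq perm_inj).
have := Ds i; rewrite /= if_neg; have [|ne] := eqVneq (s i) i; first by rewrite andbF.
rewrite andbT; case: (odd i) => /= le.
  by rewrite ltnNge le.
by have -> : (i < s i)%N by rewrite ltn_neqAle eq_sym le andbT.
Qed.

End FixedType.

(** * Summation over all types *)

Lemma sum_tuple_cons (V : nmodType) (T : finType) k (F : seq T -> V) :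
  \sum_(t : k.+1.-tuple T) F t = \sum_x \sum_(t : k.-tuple T) F (x :: t).
Proof.
rewrite pair_big /=.
rewrite (reindex (fun u : T * k.-tuple T => [tuple of u.1 :: u.2])) //=.
exists (fun t => (thead t, [tuple of behead t])) => [[x t] _|t _] /=.
  by congr (_, _); apply: val_inj.
by rewrite -tuple_eta.
Qed.

Lemma sum_option_bool (V : nmodType) (F : option bool -> V) :
  \sum_t F t = F None + F (Some false) + F (Some true).
Proof.
rewrite (bigD1 None) //= (bigD1 (Some false)) //= (bigD1 (Some true)) //=.
by rewrite big1 ?addr0 ?addrA // => -[[]|].
Qed.

Section TypeSums.
Variables (R : comNzRingType) (a b c d : nat -> nat -> R) (e f : nat -> R).

Let W := step_weight a b c d e f.
Let src i (t : option bool) : nat := ~~ odd i && (t != None).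
Let tgt (t : option bool) : nat := t == Some true.

(** [p] and [q] accumulate the counts used by [step_weight]; the final indicator expresses
    [#|S1| = #|T1|]. *)
Fixpoint seq_weight (i p q : nat) (t : seq (option bool)) : R :=
  if t is x :: t' then W i x p q * seq_weight i.+1 (p + src i x)%N (q + tgt x)%N t'
  else (p == q)%:R.

Lemma seq_weightE i p q t :
  seq_weight i p q t
  = (p + \sum_(0 <= j < size t) src (i + j) (nth None t j)
     == q + \sum_(0 <= j < size t) tgt (nth None t j))%N%:R
    * \prod_(0 <= k < size t) W (i + k)%N (nth None t k)
        (p + \sum_(0 <= j < k) src (i + j) (nth None t j))%N
        (q + \sum_(0 <= j < k) tgt (nth None t j))%N.
Proof.
elim: t i p q => [|x t IHt] i p q /=.
  by rewrite !big_geq // !addn0 mulr1.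
have srcE k : (\sum_(0 <= j < k) src (i.+1 + j) (nth None t j)
               = \sum_(0 <= j < k) src (i + j.+1) (nth None t j))%N.
  by apply: eq_bigr => j _; rewrite addSnnS.
rewrite IHt !big_nat_recl //= !addn0 !addnA srcE mulrCA; congr (_ * _).
rewrite !(big_geq (leqnn 0)) !addn0; congr (_ * _).
by apply: eq_bigr => k _; rewrite srcE addSnnS !big_nat_recl //= !addnA !addn0.
Qed.

Let A := total_weight a.
Let B := total_weight b.
Let E h := e h + total_weight c h.
Let F h := f h + total_weight d h.

(** At an odd label a valley raises the height, a double rise or fixed point keeps it ([F]); at an
    even label a peak lowers it, a double fall or fixed point keeps it ([E]). *)
Lemma sum_seq_weight (n i p q : nat) : ~~ odd i ->
  \sum_(t : (2 * n).-tuple (option bool)) seq_weight i p q t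
  = if (q <= p)%N then path_sum A B E F n (p - q)%N else 0.
Proof.
elim: n i p q => [|n IHn] i p q evi.
  rewrite (big_pred1 [tuple]) => [|t]; last by apply/esym/eqP; exact: tuple0.
  case: (leqP q p) => h; rewrite /= ?subn_eq0 eqn_leq ?h ?andbT //.
  by rewrite (leqNgt q) h andbF.
have odd_sum (p' q' : nat) : \sum_(t : (2 * n).+1.-tuple (option bool)) seq_weight i.+1 p' q' t
    = if (q' <= p')%N then even_step B E (path_sum A B E F n) (p' - q')%N else 0.
  rewrite sum_tuple_cons sum_option_bool /= -!mulr_sumr !IHn ?negbK //.
  rewrite /W /step_weight /src /tgt /= evi /= !addn0 addn1 /even_step /E.
  case: (leqP q' p') => [le|lt].
    case: (ltnP q' p') => lt.
      rewrite subnS /B; ring.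
    have -> : (p' - q' = 0)%N by lia.
    rewrite /B !total_weight0; ring.
  rewrite ltnNge ltnW //=; ring.
rewrite (_ : 2 * n.+1 = (2 * n).+2)%N; last by rewrite mulnS.
rewrite sum_tuple_cons sum_option_bool /= -!mulr_sumr !odd_sum.
rewrite /W /step_weight /src /tgt /= (negbTE evi) /= !addn0 !addn1 /odd_step /F.
rewrite !ltnS; case: (leqP q p) => [le|lt].
  rewrite leqW // subSS subSn // /A; ring.
(* A negative height could climb back to 0 by a valley, but the weight of that step is an empty
   sum. *)
have -> : (p.+1 - q = 0)%N by lia.
rewrite total_weight0; ring.
Qed.

(** In D each position lies in exactly one of the six sets, selected by its parity and type. *)
Lemma statistics_arc_weight m (s : 'S_m) (tau : 'I_m -> option bool) :
  is_Dperm s -> (forall x, arc_type s x = tau x) ->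
  (\prod_(i in Cval s) a (ucross i s) (unest i s)) *
  (\prod_(i in Cpeak s) b (lcross i s) (lnest i s)) *
  (\prod_(i in Cdfall s) c (lcross i s) (lnest i s)) *
  (\prod_(i in Cdrise s) d (ucross i s) (unest i s)) *
  (\prod_(i in Evenfix s) e (psnest i s)) *
  (\prod_(i in Oddfix s) f (psnest i s))
  = \prod_x arc_weight a b c d e f tau s x.
Proof.
move=> /forallP Ds ty.
do 6!rewrite [\prod_(i in _) _]big_mkcond /=.
rewrite -!big_split; apply: eq_bigr => x _ /=.
rewrite !inE /arc_weight -ty /arc_type /= negbK.
have := Ds x; rewrite /= if_neg.
have [sx|ne] := eqVneq (s x) x.
  have -> : (s^-1)%g x = x by rewrite -{1}sx permK.
  by rewrite sx !ltnn /= => _; case: (odd x); rewrite ?mul1r ?mulr1.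
have neV : (s^-1)%g x != x by apply: contraNneq ne => {1}<-; rewrite permKV.
case: (odd x) => /= le.
  have lt : (s x < x)%N by rewrite ltn_neqAle le andbT.
  rewrite lt [(x < s x)%N]ltnNge le !andbT !andbF.
  by have [ltV|ltV|/val_inj eqV] := ltngtP ((s^-1)%g x) x; rewrite ?mul1r ?mulr1 //; rewrite eqV eqxx in neV.
have lt : (x < s x)%N by rewrite ltn_neqAle eq_sym le andbT.
rewrite lt [(s x < x)%N]ltnNge le !andbT !andbF.
by have [ltV|ltV|/val_inj eqV] := ltngtP ((s^-1)%g x) x; rewrite ?mul1r ?mulr1 //; rewrite eqV eqxx in neV.
Qed.

Lemma card_prefix m (P : pred nat) k : (k <= m)%N ->
  #|[set y : 'I_m | (y < k)%N && P y]| = (\sum_(0 <= j < k) P j)%N.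
Proof.
move=> lek; rewrite cardsE -sum1_card big_mkord (big_ord_widen m (fun j => P j : nat) lek).
rewrite [LHS]big_mkcond [RHS]big_mkcond /=; apply: eq_bigr => y _.
by rewrite unfold_in /=; case: (y < k)%N => //=; case: (P y).
Qed.

Lemma Qpoly_path_sum n : Qpoly a b c d e f n = path_sum A B E F n 0.
Proof.
have := @sum_seq_weight n 0 0 0 isT; rewrite leqnn subnn => <-.
rewrite /Qpoly.
(* Types are encoded as tuples to match the recursion of [seq_weight]. *)
rewrite (partition_big (fun s : 'S_(2 * n) => [tuple arc_type s x | x < 2 * n]) xpredT) //=.
apply: eq_bigr => t _.
have tupleE (s : 'S_(2 * n)) : ([tuple arc_type s x | x < 2 * n] == t) = [forall x, arc_type s x == tnth t x].
  apply/eqP/forallP => [<- x | eqt]; first by rewrite tnth_mktuple.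
  by apply: eq_from_tnth => x; rewrite tnth_mktuple (eqP (eqt x)).
transitivity (\sum_(s : 'S_(2 * n) | is_Dperm s && [forall x, arc_type s x == tnth t x])
                \prod_x arc_weight a b c d e f (tnth t) s x).
  apply: eq_big => [s|s /andP[]]; rewrite tupleE inE // => Ds /forallP eqt.
  by apply: statistics_arc_weight => // x; apply/eqP.
rewrite sum_arc_type seq_weightE size_tuple !add0n.
have srcE k : (k <= 2 * n)%N ->
  #|[set y : 'I_(2 * n) | (y < k)%N && (y \in [set x : 'I_(2 * n) | ~~ odd x && (tnth t x != None)])]|
  = (\sum_(0 <= j < k) src (0 + j) (nth None t j))%N.
  move=> lek; rewrite -(card_prefix (fun j => ~~ odd j && (nth None t j != None)) lek).
  by apply: eq_card => y; rewrite !inE (tnth_nth None).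
have tgtE k : (k <= 2 * n)%N ->
  #|[set y : 'I_(2 * n) | (y < k)%N && (y \in [set x | tnth t x == Some true])]|
  = (\sum_(0 <= j < k) tgt (nth None t j))%N.
  move=> lek; rewrite -(card_prefix (fun j => nth None t j == Some true) lek).
  by apply: eq_card => y; rewrite !inE (tnth_nth None).
congr (_ * _).
  rewrite -srcE // -tgtE //; congr ((_ == _)%:R); 
    by apply: eq_card => y; rewrite !inE ltn_ord.
rewrite big_mkord; apply: eq_bigr => x _.
by rewrite (tnth_nth None) srcE ?tgtE // ltnW.
Qed.

End TypeSums.

Theorem theorem3p11 (R : comNzRingType) (a b c d : nat -> nat -> R)
    (e f : nat -> R) (alpha delta : nat -> R)
    (alpha_odd : forall k : nat, (1 <= k)%N ->
       alpha (2 * k - 1)%N =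
         (\sum_(0 <= xi < k) a (k - 1 - xi)%N xi) *
         (\sum_(0 <= xi < k) b (k - 1 - xi)%N xi))
    (alpha_even : forall k : nat, (1 <= k)%N ->
       alpha (2 * k)%N =
         (e k + \sum_(0 <= xi < k) c (k - 1 - xi)%N xi) *
         (f k + \sum_(0 <= xi < k) d (k - 1 - xi)%N xi))
    (delta_1 : delta 1%N = e 0%N * f 0%N)
    (delta_ge2 : forall n : nat, (2 <= n)%N -> delta n = 0) :
  is_tfraction alpha delta (Qpoly a b c d e f).
Proof.
pose A := total_weight a; pose B := total_weight b.
pose E h := e h + total_weight c h; pose F h := f h + total_weight d h.
have path_tf : is_tfraction alpha delta (path_sum A B E F ^~ 0%N).
  apply: path_sum_tfraction => //.
  - by move=> h; rewrite -[RHS]alpha_odd //; congr alpha; lia.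
  - by move=> h; rewrite alpha_even.
  - by rewrite delta_1 /E /F !total_weight0 !addr0.
  - exact: total_weight0.
move=> n; have [N0 tfN] := path_tf n; exists N0 => N leN.
by rewrite Qpoly_path_sum tfN.
Qed.
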